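(* Suppose that $f\in\mathcal{F}_d(\Delta,L)$ is $\Theta(2^M)$-smooth for some parameter $M>0$, and let $\epsilon,\delta\in(0,1)$. Then there exists some $T>0$ such that the output $\hat{\mathbf{x}}=\textsf{Modified-Goldstein-SG}(\mathbf{x}_0,\delta,\epsilon,T)$ is a $(\delta,\epsilon)$-Goldstein stationary point of $f$, and the required number of first-order (gradient) and zeroth-order (function value) oracle calls is bounded by $$O\left(\frac{\Delta L^2 M}{\delta\epsilon^3}\log\left(\frac{L}{\epsilon}\right)\log\left(\frac{\delta}{\epsilon}\right)\right),$$ where the problem parameters $\Delta, L>0$ are both independent of the dimension $d\ge 1$.
   Context: All norms are Euclidean. $\mathcal{F}_d(\Delta,L)$ is the set of $L$-Lipschitz functions $f:\mathbb{R}^d\to\mathbb{R}$ with $f(\mathbf{0}_d)-\inf_{\mathbf{x}} f(\mathbf{x})\le\Delta$; the initial point is $\mathbf{x}_0=\mathbf{0}_d$. $f$ is $\Theta(2^M)$-smooth: $f$ is differentiable and $\nabla f$ is Lipschitz with constant $\Theta(2^M)$. $O(\cdot)$ and $\Theta(\cdot)$ hide absolute constants that do not depend on problem parameters. Goldstein stationarity: for Lipschitz $f$, $\partial f$ denotes the Clarke subdifferential (for smooth $f$, $\partial f(\mathbf{x})=\{\nabla f(\mathbf{x})\}$), $\partial_\delta f(\mathbf{x})=\mathrm{conv}\big(\bigcup_{\mathbf{y}:\|\mathbf{y}-\mathbf{x}\|\le\delta}\partial f(\mathbf{y})\big)$, and $\mathbf{x}$ is a $(\delta,\epsilon)$-Goldstein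 stationary point if $\min\{\|\mathbf{g}\|:\mathbf{g}\in\partial_\delta f(\mathbf{x})\}\le\epsilon$. Algorithm $\textsf{Modified-Goldstein-SG}(\mathbf{x}_0,\delta,\epsilon,T)$. For $k=0,1,\dots,T-1$: - Compute $\mathbf{g}_{\mathrm{initial}}\in\partial f(\mathbf{x}_k)$ and set $W\leftarrow\{\mathbf{g}_{\mathrm{initial}}\}$. - Repeat: set $\mathbf{g}(\mathbf{x}_k)\leftarrow\mathrm{argmin}\{\|\mathbf{g}\|:\mathbf{g}\in\mathrm{conv}(W)\}$; set $\mathbf{g}_{\mathrm{new}}\leftarrow\textsf{Binary-Search}(\delta,\nabla f(\cdot),\mathbf{g}(\mathbf{x}_k),\mathbf{x}_k)$; set $W\leftarrow W\cup\{\mathbf{g}_{\mathrm{new}}\}$; until $f\big(\mathbf{x}_k-\delta\frac{\mathbf{g}(\mathbf{x}_k)}{\|\mathbf{g}(\mathbf{x}_k)\|}\big)-f(\mathbf{x}_k)\le-\frac{\delta}{2}\|\mathbf{g}(\mathbf{x}_k)\|$ or $\|\mathbf{g}(\mathbf{x}_k)\|\le\epsilon$. - If $\|\mathbf{g}(\mathbf{x}_k)\|\le\epsilon$, stop; else set $\mathbf{x}_{k+1}\leftarrow\mathbf{x}_k-\delta\frac{\mathbf{g}(\mathbf{x}_k)}{\|\mathbf{g}(\mathbf{x}_k)\|}$. Output $\mathbf{x}_k$. Subroutine $\textsf{Binary-Search}(\delta,\nabla f(\cdot),\mathbf{g}_0,\mathbf{x})$. Let $h(t)=f\big(\mathbf{x}-t\frac{\mathbf{g}_0}{\|\mathbf{g}_0\|}\big)-f(\mathbf{x})+\frac{t}{2}\|\mathbf{g}_0\|$,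 with derivative $\nabla h(t)=-\big(\nabla f(\mathbf{x}-t\frac{\mathbf{g}_0}{\|\mathbf{g}_0\|})\big)^\top\frac{\mathbf{g}_0}{\|\mathbf{g}_0\|}+\frac12\|\mathbf{g}_0\|$. Initialize $b\leftarrow\delta$, $a\leftarrow 0$, $t\leftarrow b$. Repeat: compute $\nabla h(t)$; if $\nabla h(t)<-\frac{\epsilon}{4}$, set $t\leftarrow\frac{a+b}{2}$; if $h(b)>h(t)$ set $a\leftarrow t$, else set $b\leftarrow t$; until $\nabla h(t)\ge-\frac{\epsilon}{4}$. Output $\nabla f\big(\mathbf{x}-t\frac{\mathbf{g}_0}{\|\mathbf{g}_0\|}\big)$.
   Formalization: The until-test is checked before Binary-Search is called (in the written order Binary-Search may never end), and in the O-bound the factors Δ/(δε), (L²/ε²)log(L/ε), M and log(δ/ε) are each replaced by their maximum with 1. *)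

(* Defs.v *)
From HB Require Import structures.
From mathcomp Require Import all_boot all_order all_algebra.
From mathcomp Require Import all_classical all_reals all_analysis.
Set Implicit Arguments.
Unset Strict Implicit.
Unset Printing Implicit Defensive.
Import Order.TTheory GRing.Theory Num.Theory.
Import numFieldNormedType.Exports.
Local Open Scope classical_set_scope.
Local Open Scope ring_scope.

(* The library norm `|x| on 'rV[R]_d is the sup norm, hence norm2. The topology
   and the notion of differentiability are the same for both norms. *)
Definition dot (R : realType) (d : nat) (x y : 'rV[R]_d) : R :=
  \sum_(i < d) x 0 i * y 0 i.

Definition norm2 (R : realType) (d : nat) (x : 'rV[R]_d) : R :=
  Num.sqrt (dot x x).

Definition grad (R : realType) (d : nat) (f : 'rV[R]_d -> R) (x : 'rV[R]_d) :
    'rV[R]_d :=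
  \row_(i < d) 'D_('e_i) f x.

Definition lipschitz2 (R : realType) (d e : nat) (k : R)
    (F : 'rV[R]_d -> 'rV[R]_e) : Prop :=
  forall x y, norm2 (F x - F y) <= k * norm2 (x - y).

(* The infimum is taken in \bar R: it is -oo when f is not bounded below, and
   then the last inequality fails. *)
Definition function_class (R : realType) (d : nat) (Delta L : R)
    (f : 'rV[R]_d -> R) : Prop :=
  (forall x y, `|f x - f y| <= L * norm2 (x - y)) /\
  ((f 0)%:E - ereal_inf (range (EFin \o f)) <= Delta%:E)%E.

Definition smooth (R : realType) (d : nat) (ell : R) (f : 'rV[R]_d -> R) : Prop :=
  (forall x, differentiable f x) /\ lipschitz2 ell (grad f).

Definition conv_hull (R : realType) (d : nat) (A : set 'rV[R]_d) :
    set 'rV[R]_d :=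
  [set g | exists (n : nat) (w : 'I_n -> R) (v : 'I_n -> 'rV[R]_d),
     [/\ forall i, 0 <= w i, \sum_(i < n) w i = 1, forall i, A (v i)
       & g = \sum_(i < n) w i *: v i]].

(* Clarke subdifferential of a Lipschitz function: convex hull of the limits of
   gradients along sequences of differentiability points converging to x. *)
Definition clarke (R : realType) (d : nat) (f : 'rV[R]_d -> R) (x : 'rV[R]_d) :
    set 'rV[R]_d :=
  conv_hull [set g | exists y : nat -> 'rV[R]_d,
    [/\ y @ \oo --> x, forall n, differentiable f (y n)
      & (fun n => grad f (y n)) @ \oo --> g]].

Definition goldstein (R : realType) (d : nat) (delta : R) (f : 'rV[R]_d -> R)
    (x : 'rV[R]_d) : set 'rV[R]_d :=
  conv_hull (\bigcup_(y in [set y | norm2 (y - x) <= delta]) clarke f y).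

Definition goldstein_stationary (R : realType) (d : nat) (delta eps : R)
    (f : 'rV[R]_d -> R) (x : 'rV[R]_d) : Prop :=
  exists2 g, goldstein delta f x g & norm2 g <= eps.

Definition min_norm (R : realType) (d : nat) (A : set 'rV[R]_d)
    (g : 'rV[R]_d) : Prop :=
  A g /\ forall g', A g' -> norm2 g <= norm2 g'.

(* In the three programs below, the last argument (a nat) is the number of
   oracle calls.  Each occurrence of a value of f or of its gradient is one
   call, and nothing is cached: an evaluation of h costs two calls, to f at
   x - t u and at x, and one of its derivative costs one gradient call. *)
Section Programs.
Context (R : realType) (d : nat) (f : 'rV[R]_d -> R) (delta eps : R).

Definition unit_dir (g : 'rV[R]_d) : 'rV[R]_d := (norm2 g)^-1 *: g.

Section BinarySearch.
Context (g0 x : 'rV[R]_d).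

Definition bs_h (t : R) : R :=
  f (x - t *: unit_dir g0) - f x + t / 2 * norm2 g0.

Definition bs_dh (t : R) : R :=
  - dot (grad f (x - t *: unit_dir g0)) (unit_dir g0) + 1 / 2 * norm2 g0.

(* Body of the loop on the state (a, b, t), paired with its cost: the derivative
   at t, then possibly h(b) and h(t). *)
Definition bs_body (s : R * R * R) : (R * R * R) * nat :=
  let: (a, b, t) := s in
  if bs_dh t < - (eps / 4) then
    let t' := (a + b) / 2 in
    ((if bs_h t' < bs_h b then (t', b, t') else (a, t', t')), 5%N)
  else (s, 1%N).

(* The additional call in each constructor is the until-test. *)
Inductive bs_loop : R * R * R -> R -> nat -> Prop :=
| bs_exit s a b t n :
    bs_body s = ((a, b, t), n) ->
    - (eps / 4) <= bs_dh t ->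
    bs_loop s t n.+1
| bs_again s a b t n tout m :
    bs_body s = ((a, b, t), n) ->
    bs_dh t < - (eps / 4) ->
    bs_loop (a, b, t) tout m ->
    bs_loop s tout (n.+1 + m).

Definition binary_search (gnew : 'rV[R]_d) (n : nat) : Prop :=
  exists (t : R) (m : nat),
    [/\ bs_loop (0, delta, delta) t m,
        gnew = grad f (x - t *: unit_dir g0) & n = m.+1].

End BinarySearch.

Definition exit_test (x g : 'rV[R]_d) : Prop :=
  f (x - delta *: unit_dir g) - f x <= - (delta / 2 * norm2 g) \/
  norm2 g <= eps.

(* repeat_loop x W g n: started with the list W, the repeat loop at the iterate
   x ends with g(x) = g.  The until-condition does not involve g_new and is
   tested as soon as g(x) is known: when it holds, the result of Binary-Search
   would be discarded, and that call need not terminate (f may be affine along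
   the segment, and g(x) may be 0). *)
Inductive repeat_loop (x : 'rV[R]_d) :
    seq 'rV[R]_d -> 'rV[R]_d -> nat -> Prop :=
| repeat_exit W g :
    min_norm (conv_hull [set` W]) g ->
    exit_test x g ->
    repeat_loop x W g 2
| repeat_again W g gnew n gout m :
    min_norm (conv_hull [set` W]) g ->
    ~ exit_test x g ->
    binary_search g x gnew n ->
    repeat_loop x (gnew :: W) gout m ->
    repeat_loop x W gout (2 + n + m).

(* modified_goldstein_sg x T xhat N: a complete execution with T iterations left
   from the iterate x outputs xhat.  An execution that does not stop early
   outputs the iterate produced by its last iteration. *)
Inductive modified_goldstein_sg : 'rV[R]_d -> nat -> 'rV[R]_d -> nat -> Prop :=
| gsg_budget x : modified_goldstein_sg x 0 x 0
| gsg_stop x T g0 g n :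
    clarke f x g0 ->
    repeat_loop x [:: g0] g n ->
    norm2 g <= eps ->
    modified_goldstein_sg x T.+1 x n.+1
| gsg_step x T g0 g n xhat m :
    clarke f x g0 ->
    repeat_loop x [:: g0] g n ->
    eps < norm2 g ->
    modified_goldstein_sg (x - delta *: unit_dir g) T xhat m ->
    modified_goldstein_sg x T.+1 xhat (n.+1 + m).

End Programs.

(* (Delta / (delta eps)) (L^2 / eps^2 log (L / eps)) M log (delta / eps), i.e.
   Delta L^2 M / (delta eps^3) log (L / eps) log (delta / eps), where the bound
   on the number of passes through each of the two outer loops and each of the
   two factors of the bound for the binary search are understood to be at least
   1.  Without this convention the bound could be close to 0 or negative (e.g.
   for delta <= eps), whereas an execution makes at least one call. *)
Definition oracle_bound (R : realType) (Delta L M delta eps : R) : R :=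
  Num.max 1 (Delta / (delta * eps)) *
  Num.max 1 (L ^+ 2 / eps ^+ 2 * ln (L / eps)) *
  (Num.max 1 M * Num.max 1 (ln (delta / eps))).

(* Main.v *)
(** Outer loop: a step that does not stop decreases [f] by more than
    [delta * eps / 2], so fewer than [T] of them fit in [Delta].
    Inner loop: Binary-Search returns a gradient [gnew] at distance at most [delta]
    with [dot gnew g <= 3/4 * |g|^2], and moving the minimal-norm point [g] towards
    [gnew] multiplies [|g|^2] by at most [1 - |g|^2 / (64 L^2)], hence
    [O (L^2/eps^2 * ln (L/eps))] passes take it from [L^2] to [eps^2].
    Binary search: the bisection keeps [h a < h b], so by the mean value theorem
    [h'] is positive somewhere in [[a, b]]; since [h'] is [ell]-Lipschitz,
    [h' >= - eps/4] on the whole interval as soon as [ell * (b - a) <= eps/4],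
    which happens after [O (M + ln (delta/eps))] halvings. *)
Require Import Defs.
From mathcomp Require Import all_boot all_order all_algebra.
From mathcomp Require Import all_classical all_reals all_analysis.
From mathcomp Require Import ring lra zify.
Import Order.TTheory GRing.Theory Num.Theory.
Import numFieldNormedType.Exports.
Local Open Scope ring_scope.
Set Implicit Arguments.
Unset Strict Implicit.
Unset Printing Implicit Defensive.

Lemma sum_continuous (R : realType) (V : normedModType R) (T : topologicalType)
    (I : Type) (r : seq I) (F : I -> T -> V) :
  (forall i, continuous (F i)) -> continuous (fun t => \sum_(i <- r) F i t).
Proof. by move=> cF; apply: continuous_big => //; exact: add_continuous. Qed.

(** * Euclidean inner product and norm on row vectors *)

Section Euclidean.
Context {R : realType} {d : nat}.
Implicit Types (x y z : 'rV[R]_d) (c : R).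

Lemma dotC x y : dot x y = dot y x.
Proof. by apply: eq_bigr => i _; rewrite mulrC. Qed.

Lemma dotDl x y z : dot (x + y) z = dot x z + dot y z.
Proof. by rewrite -big_split; apply: eq_bigr => i _; rewrite mxE mulrDl. Qed.

Lemma dotZl c x y : dot (c *: x) y = c * dot x y.
Proof. by rewrite /dot mulr_sumr; apply: eq_bigr => i _; rewrite mxE mulrA. Qed.

Lemma dotDr x y z : dot z (x + y) = dot z x + dot z y.
Proof. by rewrite dotC dotDl !(dotC z). Qed.

Lemma dotZr c x y : dot y (c *: x) = c * dot y x.
Proof. by rewrite dotC dotZl dotC. Qed.

Lemma dotNl x y : dot (- x) y = - dot x y.
Proof. by rewrite -scaleN1r dotZl mulN1r. Qed.

Lemma dotNr x y : dot y (- x) = - dot y x.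
Proof. by rewrite dotC dotNl dotC. Qed.

Lemma dot_suml n (w : 'I_n -> R) (v : 'I_n -> 'rV[R]_d) y :
  dot (\sum_i w i *: v i) y = \sum_i w i * dot (v i) y.
Proof.
rewrite /dot.
under eq_bigr do rewrite summxE mulr_suml.
rewrite exchange_big; apply: eq_bigr => i _; rewrite mulr_sumr.
by apply: eq_bigr => j _; rewrite mxE mulrA.
Qed.

Lemma dot_ge0 x : 0 <= dot x x.
Proof. by apply: sumr_ge0 => i _; rewrite -expr2 sqr_ge0. Qed.

Lemma norm2_ge0 x : 0 <= norm2 x.
Proof. exact: sqrtr_ge0. Qed.

Lemma norm2_sqr x : norm2 x ^+ 2 = dot x x.
Proof. exact: sqr_sqrtr (dot_ge0 x). Qed.

Lemma norm2_eq0 x : norm2 x = 0 -> x = 0.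
Proof.
move=> x0; have : dot x x = 0 by rewrite -norm2_sqr x0 expr0n.
move=> /eqP; rewrite psumr_eq0 => [|i _]; last by rewrite -expr2 sqr_ge0.
move=> /allP xi0; apply/rowP => i; rewrite mxE.
by have := xi0 i (mem_index_enum i); rewrite -expr2 sqrf_eq0 => /eqP.
Qed.

Lemma norm2Z c x : norm2 (c *: x) = `|c| * norm2 x.
Proof.
by rewrite /norm2 dotZl dotZr mulrA sqrtrM -?expr2 ?sqr_ge0// sqrtr_sqr.
Qed.

Lemma norm2N x : norm2 (- x) = norm2 x.
Proof. by rewrite -scaleN1r norm2Z normrN1 mul1r. Qed.

(** For nonzero vectors, the squared norm of [norm2 y *: x - norm2 x *: y] is nonnegative and
    factors as [2 * (norm2 x * norm2 y) * (norm2 x * norm2 y - dot x y)]. *)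
Lemma cauchy_schwarz x y : dot x y <= norm2 x * norm2 y.
Proof.
have [x0|x0] := eqVneq (norm2 x) 0.
  by rewrite x0 mul0r (norm2_eq0 x0) -(scale0r x) dotZl mul0r.
have [y0|y0] := eqVneq (norm2 y) 0.
  by rewrite y0 mulr0 (norm2_eq0 y0) -(scale0r x) dotZr mul0r.
have xy0 : 0 < norm2 x * norm2 y.
  by rewrite mulr_gt0// lt_def ?x0 ?y0 norm2_ge0.
have := dot_ge0 (norm2 y *: x - norm2 x *: y).
rewrite !(dotDl, dotDr, dotNl, dotNr, dotZl, dotZr) -!norm2_sqr (dotC y x).
rewrite (_ : _ + _ = 2 * (norm2 x * norm2 y) * (norm2 x * norm2 y - dot x y)).
  by rewrite pmulr_rge0 ?subr_ge0// mulr_gt0.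
by ring.
Qed.

Lemma le_dot_norm2 x y : norm2 x <= norm2 y -> dot x x <= dot y y.
Proof. by move=> xy; rewrite -!norm2_sqr ler_pXn2r ?nnegrE ?norm2_ge0. Qed.

Lemma norm2_unit_dir x : 0 < norm2 x -> norm2 (unit_dir x) = 1.
Proof.
by move=> x0; rewrite norm2Z ger0_norm ?invr_ge0 ?norm2_ge0// mulVf ?gt_eqF.
Qed.

Lemma continuous_dot (T : topologicalType) (F G : T -> 'rV[R]_d) :
  continuous F -> continuous G -> continuous (fun t => dot (F t) (G t)).
Proof.
move=> cF cG; apply: (@sum_continuous _ R^o) => i t.
by apply: (@continuousM R T (fun t => F t 0 i) (fun t => G t 0 i));
  [apply: (@continuous_comp _ _ _ F (fun x : 'rV[R]_d => x 0 i))
  |apply: (@continuous_comp _ _ _ G (fun x : 'rV[R]_d => x 0 i))];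
  [exact: cF|exact: coord_continuous|exact: cG|exact: coord_continuous].
Qed.

Lemma continuous_norm2 (T : topologicalType) (F : T -> 'rV[R]_d) :
  continuous F -> continuous (fun t => norm2 (F t)).
Proof.
move=> cF t; apply: (@continuous_comp _ _ _ (fun t => dot (F t) (F t)) Num.sqrt).
  exact: continuous_dot.
exact: sqrt_continuous.
Qed.

End Euclidean.

(** * Convex hulls and their points of minimal norm *)

Section ConvexHull.
Context {R : realType} {d : nat}.
Implicit Types (A B : set 'rV[R]_d) (x y : 'rV[R]_d).

Lemma conv_hull1 A x : A x -> conv_hull A x.
Proof.
move=> Ax; exists 1, (fun=> 1), (fun=> x); split=> //.
- by rewrite big_ord1.
- by rewrite big_ord1 scale1r.
Qed.

Lemma conv_hullS A B : (A `<=` B)%classic -> (conv_hull A `<=` conv_hull B)%classic.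
Proof.
move=> AB x [n [w [v [w0 w1 Av ->]]]].
by exists n, w, v; split=> // i; exact: AB.
Qed.

Lemma conv_hull_segment A x y (c : R) : A x -> conv_hull A y -> 0 <= c <= 1 ->
  conv_hull A (c *: x + (1 - c) *: y).
Proof.
move=> Ax [n [w [v [w0 w1 Av ->]]]] /andP[c0 c1].
(* The new index [ord0] carries [x] with weight [c]; the old weights are scaled by [1 - c]. *)
exists n.+1, (fun i => oapp (fun j => (1 - c) * w j) c (unlift ord0 i)),
  (fun i => oapp v x (unlift ord0 i)); split.
- by move=> i; case: unliftP => [j _|_] //=; rewrite mulr_ge0// subr_ge0.
- rewrite big_ord_recl unlift_none /=.
  under eq_bigr do rewrite liftK /=.
  by rewrite -mulr_sumr w1 mulr1 subrKC.
- by move=> i; case: unliftP => [j _|_] /=.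
- rewrite big_ord_recl unlift_none /=.
  under [in RHS]eq_bigr do rewrite liftK /= -scalerA.
  by rewrite -scaler_sumr.
Qed.

Lemma conv_hull_seq_neq_nil (W : seq 'rV[R]_d) x :
  conv_hull [set` W]%classic x -> W != [::].
Proof.
apply: contraPneq => -> [[|n] [w [v [_ w1 Wv _]]]]; last by have := Wv ord0.
by move: w1 => /eqP; rewrite big_ord0 eq_sym oner_eq0.
Qed.

(** Pairing the convex combination with [x] itself and applying Cauchy-Schwarz to each term gives
    [norm2 x ^+ 2 <= L * norm2 x]. *)
Lemma conv_hull_norm2_le A (L : R) x : 0 <= L ->
  (forall y, A y -> norm2 y <= L) -> conv_hull A x -> norm2 x <= L.
Proof.
move=> L0 AL [n [w [v [w0 w1 Av xE]]]].
have [->//|x0] := eqVneq (norm2 x) 0.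
have {}x0 : 0 < norm2 x by rewrite lt_def x0 norm2_ge0.
rewrite -(ler_pM2r x0) -expr2 norm2_sqr {1}xE dot_suml.
rewrite -[leRHS]mul1r -w1 mulr_suml; apply: ler_sum => i _.
rewrite ler_wpM2l// (le_trans (cauchy_schwarz _ _))// ler_wpM2r ?norm2_ge0//.
exact: AL.
Qed.

(** The number of terms in [conv_hull] is arbitrary. Adding up the weights of all terms that sit at
    the same position of [W] fixes it to [size W], so that the hull becomes the image of one
    simplex. *)
Lemma conv_hull_seqE (W : seq 'rV[R]_d) x : conv_hull [set` W]%classic x ->
  exists2 w : 'rV[R]_(size W), (forall j, 0 <= w 0 j <= 1) /\ \sum_j w 0 j = 1
    & x = \sum_j w 0 j *: W`_j.
Proof.
move=> [n [w [v [w0 w1 Wv ->]]]].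
pose p (i : 'I_n) : 'I_(size W) :=
  Ordinal (etrans (index_mem (v i) W) (Wv i)).
have pE i : W`_(p i) = v i by rewrite nth_index//; exact: Wv.
exists (\row_j \sum_(i | p i == j) w i); first split.
- move=> j; rewrite mxE sumr_ge0//= -w1 [leRHS](bigID (fun i => p i == j))/=.
  by rewrite lerDl sumr_ge0.
- under eq_bigr do rewrite mxE.
  by rewrite -w1 [RHS](partition_big p predT).
- rewrite (partition_big p predT)//=; apply: eq_bigr => j _.
  rewrite mxE scaler_suml; apply: eq_bigr => i /eqP <-.
  by rewrite pE.
Qed.

(** The simplex [S] of weights is compact and the combination map [F] is continuous, so the norm
    attains its minimum on the hull by the extreme value theorem. *)
Lemma min_norm_conv_hull_ex (W : seq 'rV[R]_d) : W != [::] ->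
  exists g, min_norm (conv_hull [set` W]%classic) g.
Proof.
case: W => // x0 W0 _; set W := x0 :: W0.
pose F (w : 'rV[R]_(size W)) : 'rV[R]_d := \sum_j w 0 j *: W`_j.
pose S : set 'rV[R]_(size W) :=
  ([set w | forall j, `[0, 1]%classic (w ord0 j)] `&`
   [set w | \sum_j w 0 j = 1])%classic.
have cS : compact S.
  apply: compact_closedI.
    apply: (@rV_compact R (size W) (fun=> `[0, 1]%classic)) => i.
    exact: segment_compact.
  apply: (@preimage_closed _ _ (fun w : 'rV[R]_(size W) => \sum_j w 0 j)
    [set 1]%classic).
    move=> w _; apply: (@sum_continuous _ R^o) => i.
    exact: coord_continuous.
  exact: closed_eq.
have cF : continuous F.
  apply: sum_continuous => i w.
  exact: (cvgZr_tmp (@coord_continuous R 1 (size W) 0 i w)).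
have SF w : S w -> conv_hull [set` W]%classic (F w).
  move=> [w01 w1]; exists (size W), (w 0), (fun j => W`_j); split=> //.
    by move=> i; have := w01 i; rewrite /= in_itv /= => /andP[].
  by move=> i; exact: mem_nth.
have FS g : conv_hull [set` W]%classic g -> exists2 w, S w & g = F w.
  by move=> /conv_hull_seqE[w [w01 w1] ->]; exists w.
have S0 : (S !=set0)%classic.
  have /FS[w Sw _] : conv_hull [set` W]%classic x0.
    by apply: conv_hull1; rewrite /= mem_head.
  by exists w.
have [|w wS Fw] := @EVT_min_rV _ _ (fun w => norm2 (F w)) S S0 cS.
  by apply: continuous_subspaceT; exact: continuous_norm2.
exists (F w); split; first by apply: SF; exact/set_mem.
by move=> _ /FS[u Su ->]; apply: Fw; exact/mem_set.
Qed.

End ConvexHull.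

(** * Gradients and Clarke subgradients of a Lipschitz function *)

Section Gradient.
Context {R : realType} {d : nat}.
Implicit Types (f : 'rV[R]_d -> R) (x v : 'rV[R]_d).

Lemma dot_grad f x v : differentiable f x -> dot (grad f x) v = 'D_v f x.
Proof.
move=> df; rewrite deriveE// {2}(row_sum_delta v) linear_sum.
by apply: eq_bigr => i _; rewrite mxE deriveE// linearZ mulrC.
Qed.

Lemma is_derive_line f x v (t : R) : differentiable f (x + t *: v) ->
  is_derive t 1 (fun s : R => f (x + s *: v)) (dot (grad f (x + t *: v)) v).
Proof.
move=> df.
have dl : is_diff t (fun s : R => x + s *: v) (fun s : R => s *: v).
  by apply: is_diff_eq; apply/funext => s /=; rewrite add0r.
have dfl : differentiable (fun s : R => f (x + s *: v)) t.
  exact: (@differentiable_comp _ _ _ _ (fun s : R => x + s *: v) f).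
split; first exact: diff_derivable.
rewrite deriveE// dot_grad// deriveE//.
rewrite (@diff_comp _ _ _ _ (fun s : R => x + s *: v) f)//=.
by rewrite diff_val scale1r.
Qed.

(** With [g] the gradient, the derivative in the direction [g] equals [norm2 g ^+ 2], while the
    Lipschitz condition bounds each difference quotient in that direction by [L * norm2 g]. *)
Lemma norm2_grad_le f (L : R) x : 0 <= L ->
  (forall x y, `|f x - f y| <= L * norm2 (x - y)) -> differentiable f x ->
  norm2 (grad f x) <= L.
Proof.
move=> L0 fL df; set g := grad f x.
have [->//|g0] := eqVneq (norm2 g) 0.
have {}g0 : 0 < norm2 g by rewrite lt_def g0 norm2_ge0.
rewrite -(ler_pM2r g0) -expr2 norm2_sqr dot_grad//.
have dfg : derivable f x g by exact: diff_derivable.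
apply: limr_le; first exact: dfg.
near=> h.
have h0 : h != 0 by near: h; exact: nbhs_dnbhs_neq.
rewrite /= (le_trans (ler_norm _))// normrM normfV ler_pdivrMl ?normr_gt0//.
rewrite (le_trans (fL _ _))// addrK norm2Z.
by rewrite mulrCA.
Unshelve. all: by end_near. Qed.

Lemma clarke_grad f x : differentiable f x -> clarke f x (grad f x).
Proof.
move=> df; apply: conv_hull1; exists (fun=> x).
by split=> //; exact: cvg_cst.
Qed.

Lemma norm2_clarke_le f (L : R) x g : 0 <= L ->
  (forall x y, `|f x - f y| <= L * norm2 (x - y)) -> clarke f x g ->
  norm2 g <= L.
Proof.
move=> L0 fL; apply: conv_hull_norm2_le => // {}g [y [_ dy gy]].
have ng : ((fun n => norm2 (grad f (y n))) @ \oo --> norm2 g)%classic.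
  apply: (continuous_cvg _ _ gy); apply: (@continuous_norm2 R d 'rV[R]_d id).
  by move=> x0; exact: cvg_id.
rewrite -(cvg_lim _ ng)//; apply: limr_le.
  by apply/cvg_ex; exists (norm2 g).
by near=> n; exact: norm2_grad_le.
Unshelve. all: by end_near. Qed.

End Gradient.

(** * Binary search along a descent segment *)

Section Algorithm.
Context {R : realType} {d : nat} {f : 'rV[R]_d -> R} {L ell delta eps : R}.
Hypothesis L_gt0 : 0 < L.
Hypothesis f_lip : forall x y, `|f x - f y| <= L * norm2 (x - y).
Hypothesis ell_ge0 : 0 <= ell.
Hypothesis f_smooth : smooth ell f.
Hypothesis eps_gt0 : 0 < eps.
Hypothesis delta_gt0 : 0 < delta.

Section BinarySearch.
Variables (g0 x : 'rV[R]_d).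
Hypothesis g0_gt0 : 0 < norm2 g0.

Local Notation h := (bs_h f g0 x).
Local Notation dh := (bs_dh f g0 x).

Lemma is_derive_bs_h (t : R) : is_derive t 1 h (dh t).
Proof.
have [df _] := f_smooth.
have := @is_derive_line _ _ _ x (- unit_dir g0) t (df _).
rewrite dotNr scalerN => dl; rewrite /bs_h /bs_dh.
under eq_fun do rewrite -scalerN.
have dn : is_derive t 1 (fun s : R => s / 2 * norm2 g0) (1 / 2 * norm2 g0).
  have -> : (fun s : R => s / 2 * norm2 g0) = (2^-1 * norm2 g0) \*: id.
    by apply/funext => s /=; rewrite /GRing.scale /=; ring.
  by apply: is_derive_eq; rewrite /GRing.scale /=; ring.
have dc : is_derive t 1 (cst (- f x)) 0 by exact: is_derive_cst.
have := is_deriveD (is_deriveD dl dc) dn.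
by rewrite addr0.
Qed.

Lemma bs_dh_lip s t : `|dh s - dh t| <= ell * `|s - t|.
Proof.
have [_ lf] := f_smooth.
set u := unit_dir g0; set G := fun r : R => grad f (x - r *: u).
have u1 : norm2 u = 1 by exact: norm2_unit_dir.
have -> : dh s - dh t = dot (G t - G s) u.
  by rewrite dotDl dotNl /bs_dh -/u /G; ring.
have G_lip a b : norm2 (G a - G b) <= ell * `|a - b|.
  rewrite (le_trans (lf _ _))//.
  have -> : x - a *: u - (x - b *: u) = (b - a) *: u.
    by rewrite opprB addrC addrA subrK scalerBl.
  by rewrite norm2Z u1 mulr1 distrC.
rewrite ler_norml; apply/andP; split.
  rewrite lerNl -dotNl opprB (le_trans (cauchy_schwarz _ _))// u1 mulr1.
  exact: G_lip.
by rewrite (le_trans (cauchy_schwarz _ _))// u1 mulr1 distrC G_lip.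
Qed.

(** Invariant of the bisection. The strict inequality [h a < h b] forces [h] to increase somewhere
    in between; [t] is kept in the interval so that the Lipschitz bound on [dh] reaches it. *)
Definition bs_inv (a b t : R) :=
  [/\ 0 <= a, a <= t, t <= b, b <= delta & h a < h b].

Lemma bs_inv_short a b t : bs_inv a b t -> ell * (b - a) <= eps / 4 ->
  - (eps / 4) <= dh t.
Proof.
move=> [a0 at_ tb bd hab] short.
have ab : a < b.
  by rewrite lt_neqAle (le_trans at_ tb) andbT; apply: contraTneq hab => ->;
    rewrite ltxx.
have [||c /[!in_itv]/= /andP[ac cb] hE] := @MVT R h dh a b ab.
- by move=> s _; exact: is_derive_bs_h.
- apply: derivable_within_continuous => s _.
  by have [] := is_derive_bs_h s.
have dc : 0 < dh c.
  by rewrite -(pmulr_lgt0 _ (_ : 0 < b - a)) -?hE subr_gt0.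
have := bs_dh_lip c t.
have : ell * `|c - t| <= ell * (b - a).
  by rewrite ler_wpM2l// ler_norml; apply/andP; split; lra.
move=> H1 H2; have := ler_norm (dh c - dh t).
lra.
Qed.

(** Both branches keep [h a < h b]: the midpoint becomes the left end when its value is below [h b],
    and otherwise the right end, with a value at least [h b]. *)
Lemma bs_body_inv a b t : bs_inv a b t -> dh t < - (eps / 4) ->
  exists a' b' t', [/\ bs_body f eps g0 x (a, b, t) = ((a', b', t'), 5%N),
    bs_inv a' b' t' & b' - a' = (b - a) / 2].
Proof.
move=> [a0 at_ tb bd hab] dht; rewrite /bs_body dht.
have ab := le_trans at_ tb.
case: ltP => hb.
- exists ((a + b) / 2), b, ((a + b) / 2).
  by split=> //; [split=> //|]; lra.
- exists a, ((a + b) / 2), ((a + b) / 2).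
  by split=> //; [split=> //|]; lra.
Qed.

(** The program is a relation, so the existence of a run and the bounds on every run are proved
    together, by induction on the number [k] of halvings left. A halving costs six calls, five in
    the body and one in the until-test; a pass that finds [t] already acceptable costs two. *)
Lemma bs_loop_spec k a b t : bs_inv a b t -> ell * (b - a) <= 2 ^+ k * (eps / 4) ->
  (exists tout m, bs_loop f eps g0 x (a, b, t) tout m) /\
  forall tout m, bs_loop f eps g0 x (a, b, t) tout m ->
    [/\ 0 <= tout <= delta, - (eps / 4) <= dh tout & (m <= 6 * k + 2)%N].
Proof.
have stop a' b' t' : bs_inv a' b' t' -> - (eps / 4) <= dh t' ->
  (exists tout m, bs_loop f eps g0 x (a', b', t') tout m) /\
  forall tout m, bs_loop f eps g0 x (a', b', t') tout m ->
    [/\ 0 <= tout <= delta, - (eps / 4) <= dh tout & (m <= 2)%N].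
  move=> [a0 at_ tb bd _] dht.
  have bodyE : bs_body f eps g0 x (a', b', t') = ((a', b', t'), 1%N).
    by rewrite /bs_body ltNge dht.
  split; first by exists t', 2; exact: (bs_exit bodyE).
  move=> tout m loop.
  inversion loop as [s a1 b1 t1 n1 E1 dht1|s a1 b1 t1 n1 tout1 m1 E1 dht1]; subst.
    move: E1; rewrite bodyE => -[_ _ <- <-].
    by split=> //; rewrite (le_trans a0 at_) (le_trans tb bd).
  by move: E1 dht1; rewrite bodyE => -[_ _ <- _]; rewrite ltNge dht.
elim: k a b t => [|k IHk] a b t inv short.
  apply: stop => //; apply: bs_inv_short inv _.
  by rewrite expr0 mul1r in short.
have [dht|dht] := leP (- (eps / 4)) (dh t).
  have [ex all] := stop _ _ _ inv dht.
  by split=> // tout m /all[? ? m2]; split=> //; rewrite (leq_trans m2)// leq_addl.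
have [a' [b' [t' [bodyE inv' ba']]]] := bs_body_inv inv dht.
have [||[tout' [m' loop']] all'] := IHk a' b' t'; first exact: inv'.
  by rewrite ba' exprS in short *; lra.
split.
  have [dht'|dht'] := leP (- (eps / 4)) (dh t').
    by exists t', 6; exact: (bs_exit bodyE).
  by exists tout', (6 + m')%N; exact: (bs_again bodyE).
move=> tout m loop.
inversion loop as [s a1 b1 t1 n1 E1 dht1|s a1 b1 t1 n1 tout1 m1 E1 dht1 loop1];
  subst.
  move: E1 dht1; rewrite bodyE => -[_ _ <- <-] dht1.
  have [_ at_ tb bd _] := inv'; have [a0 _ _ _ _] := inv'.
  split=> //; first by rewrite (le_trans a0 at_) (le_trans tb bd).
  lia.
move: E1 loop1; rewrite bodyE => -[<- <- <- <-] /all'[? ? m1k]; split=> //.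
lia.
Qed.

End BinarySearch.

(** * Repeat loop: shrinking the minimal-norm point *)

Definition near_grads (x : 'rV[R]_d) : set 'rV[R]_d :=
  (\bigcup_(y in [set y | norm2 (y - x) <= delta]) clarke f y)%classic.

Lemma near_grads_norm2_le x g : near_grads x g -> norm2 g <= L.
Proof. by move=> [y _]; apply: norm2_clarke_le => //; exact: ltW. Qed.

Variable k : nat.
Hypothesis delta_le : ell * delta <= 2 ^+ k * (eps / 4).

Lemma binary_search_spec g x : ~ exit_test f delta eps x g ->
  (exists gnew n, binary_search f delta eps g x gnew n) /\
  forall gnew n, binary_search f delta eps g x gnew n ->
    [/\ near_grads x gnew, dot gnew g <= 3 / 4 * dot g g & (n <= 6 * k + 3)%N].
Proof.
move=> /not_orP[/negP]; rewrite -ltNge => dec /negP; rewrite -ltNge => eps_g.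
have g_gt0 : 0 < norm2 g by exact: lt_trans eps_g.
(* Here [h 0 = 0], and [0 < h delta] is exactly the failure of the descent test. *)
have inv : bs_inv g x 0 delta delta.
  split=> //; first exact: ltW.
  rewrite /bs_h scale0r subr0 mul0r mul0r; lra.
have [|[t [m loop]] all] := @bs_loop_spec _ x g_gt0 k _ _ _ inv.
  by rewrite subr0.
split; first by exists (grad f (x - t *: unit_dir g)), m.+1, t, m.
move=> gnew n [t' [m' [/all[/andP[t0 td] dht mk] -> ->]]]; split; last lia.
- exists (x - t' *: unit_dir g); last by apply: clarke_grad; case: f_smooth.
  by rewrite /= addrAC subrr add0r norm2N norm2Z norm2_unit_dir// ger0_norm// mulr1.
- set G := grad f _ in dht *.
  have -> : g = norm2 g *: unit_dir g.
    by rewrite /unit_dir scalerA divff ?scale1r ?gt_eqF.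
  rewrite dotZr -(norm2_sqr (_ *: _)) norm2Z norm2_unit_dir// mulr1.
  rewrite ger0_norm ?norm2_ge0//.
  have -> : 3 / 4 * norm2 g ^+ 2 = norm2 g * (3 / 4 * norm2 g) by ring.
  (* The bound on [dh] reads [dot G u <= norm2 g / 2 + eps / 4] with [u := unit_dir g], and
     [eps < norm2 g] turns this into the factor 3/4. *)
  rewrite ler_pM2l//; move: dht; rewrite /bs_dh -/G; lra.
Qed.

Lemma conv_hull_shrink (A : set 'rV[R]_d) g gnew :
  norm2 g <= L -> norm2 gnew <= L -> A gnew -> conv_hull A g ->
  dot gnew g <= 3 / 4 * dot g g ->
  exists2 c, conv_hull A c &
    dot c c <= (1 - dot g g / (64 * L ^+ 2)) * dot g g.
Proof.
move=> gL gnewL Agnew Ag; set q := dot g g; set D := dot gnew g => Dq.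
have q0 : 0 <= q by exact: dot_ge0.
have qL : q <= L ^+ 2 by rewrite /q -norm2_sqr lerXn2r ?nnegrE ?norm2_ge0 ?(ltW L_gt0).
have NL : dot gnew gnew <= L ^+ 2.
  by rewrite -norm2_sqr lerXn2r ?nnegrE ?norm2_ge0 ?(ltW L_gt0).
have L2 : 0 < L ^+ 2 by rewrite exprn_gt0.
(* This [l] minimizes [q - l * q / 2 + l ^+ 2 * (2 * L) ^+ 2], which bounds the
   squared norm of the point of parameter [l] on the segment [[g, gnew]]. *)
pose l := q / (16 * L ^+ 2).
have l0 : 0 <= l by rewrite divr_ge0// mulr_ge0// ltW.
have l1 : l <= 1 by rewrite ler_pdivrMr ?mulr_gt0// mul1r; lra.
exists (l *: gnew + (1 - l) *: g).
  by apply: conv_hull_segment => //; rewrite l0.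
have -> : q / (64 * L ^+ 2) = l / 4 by rewrite /l; field; rewrite gt_eqF.
have lL : l ^+ 2 * L ^+ 2 = l * q / 16 by rewrite /l; field; rewrite gt_eqF.
rewrite !(dotDl, dotDr, dotZl, dotZr) (dotC g gnew) -/D -/q.
have h1 : l ^+ 2 * dot gnew gnew <= l ^+ 2 * L ^+ 2.
  by rewrite ler_wpM2l// sqr_ge0.
have h2 : l * (1 - l) * D <= l * (1 - l) * (3 / 4 * q).
  by rewrite ler_wpM2l// mulr_ge0// subr_ge0.
have h3 : 0 <= l * q by rewrite mulr_ge0.
have h4 : 0 <= l ^+ 2 * q by rewrite mulr_ge0// sqr_ge0.
(* The collected bounds give at most [q - 7 / 16 * l * q - l ^+ 2 * q / 2], which is below the
   required [q - l * q / 4]. *)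
lra.
Qed.

(** Any hull point [c] may certify that [j] more passes suffice, because the minimal-norm point is
    no longer than [c]; each pass supplies a shorter certificate. A pass that continues costs two
    calls for the test and at most [6 * k + 3] for the search; the last one costs only the test. *)
Lemma repeat_loop_spec j x (W : seq 'rV[R]_d) c :
  ([set` W] `<=` near_grads x)%classic -> conv_hull [set` W]%classic c ->
  dot c c * (1 - eps ^+ 2 / (64 * L ^+ 2)) ^+ j <= eps ^+ 2 ->
  (exists g n, repeat_loop f delta eps x W g n) /\
  forall g n, repeat_loop f delta eps x W g n ->
    [/\ goldstein delta f x g, exit_test f delta eps x g
      & (n <= 2 + j * (6 * k + 5))%N].
Proof.
have eps_le y : (norm2 y <= eps) = (dot y y <= eps ^+ 2).
  by rewrite -norm2_sqr ler_pXn2r// nnegrE ?norm2_ge0// ltW.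
set r := 1 - _.
elim: j W c => [|j IHj] W c WG Wc cj.
  rewrite expr0 mulr1 in cj.
  have exit g : min_norm (conv_hull [set` W]%classic) g -> norm2 g <= eps.
    by move=> [_ /(_ _ Wc)] /le_trans; apply; rewrite eps_le.
  split.
    have W0 := conv_hull_seq_neq_nil Wc.
    have [g mg] := min_norm_conv_hull_ex W0.
    by exists g, 2; apply: repeat_exit => //; right; exact: exit.
  move=> g n loop; inversion loop as [W1 g1 mg et|W1 g1 gnew n1 gout m1 mg net]; subst.
    by split=> //; apply: conv_hullS WG _ _; have [] := mg.
  by case: net; right; exact: exit.
have W0 := conv_hull_seq_neq_nil Wc.
have next g gnew n : min_norm (conv_hull [set` W]%classic) g ->
    ~ exit_test f delta eps x g -> binary_search f delta eps g x gnew n ->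
    ([set` (gnew :: W)] `<=` near_grads x)%classic /\
    exists2 c', conv_hull [set` (gnew :: W)]%classic c' &
    dot c' c' * r ^+ j <= eps ^+ 2.
  move=> [Wg mg] net bs; have [_ /(_ _ _ bs)[Ggnew Dq _]] := binary_search_spec net.
  split.
    by move=> y /=; rewrite inE => /predU1P[->//|]; exact: WG.
  have epsg : eps < norm2 g by rewrite ltNge; apply/negP => ge; apply: net; right.
  have gL : norm2 g <= L.
    apply: conv_hull_norm2_le Wg; first exact: ltW.
    by move=> y /WG; exact: near_grads_norm2_le.
  have [|||c' Wc' c'le] := @conv_hull_shrink [set` (gnew :: W)]%classic _ _ gL _ _ _ Dq.
  - exact: near_grads_norm2_le Ggnew.
  - by rewrite /= mem_head.
  - by apply: conv_hullS Wg => y /=; rewrite inE => ->; rewrite orbT.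
  exists c' => //; apply: le_trans cj.
  have L2 : 0 < 64 * L ^+ 2 by rewrite mulr_gt0// exprn_gt0.
  (* The sign of [r] follows from [eps < norm2 g] and [norm2 g <= L]. *)
  have r0 : 0 <= r.
    rewrite subr_ge0 ler_pdivrMr// mul1r.
    have : eps ^+ 2 <= L ^+ 2.
      by rewrite lerXn2r ?nnegrE ?(ltW eps_gt0) ?(ltW L_gt0)//
        (ltW (lt_le_trans epsg gL)).
    by have := sqr_ge0 L; lra.
  have gc : dot g g <= dot c c by apply: le_dot_norm2; exact: mg.
  rewrite exprS mulrA ler_wpM2r ?exprn_ge0// (le_trans c'le)//.
  rewrite mulrC ler_pM ?dot_ge0//.
    rewrite subr_ge0 ler_pdivrMr// mul1r.
    have : dot g g <= L ^+ 2.
      by rewrite -norm2_sqr lerXn2r ?nnegrE ?norm2_ge0 ?(ltW L_gt0).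
    by have := sqr_ge0 L; lra.
  (* Since [g] fails the test, [eps ^+ 2 < dot g g], so the actual contraction factor is at most the
     uniform factor [r]. *)
  rewrite lerD2l lerN2 ler_pM2r ?invr_gt0//.
  by rewrite ltW// ltNge -eps_le -ltNge.
split.
  have [g mg] := min_norm_conv_hull_ex W0.
  have [et|net] := pselect (exit_test f delta eps x g).
    by exists g, 2; exact: repeat_exit.
  have [[gnew [n bs]] _] := binary_search_spec net.
  have [WG' [c' Wc' c'j]] := next _ _ _ mg net bs.
  have [[g' [n' loop']] _] := IHj _ _ WG' Wc' c'j.
  by exists g', (2 + n + n')%N; exact: (repeat_again mg net bs loop').
move=> g n loop.
inversion loop as [W1 g1 mg et|W1 g1 gnew n1 gout m1 mg net bs loop1]; subst.
  by split=> //; apply: conv_hullS WG _ _; have [] := mg.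
have [WG' [c' Wc' c'j]] := next _ _ _ mg net bs.
have [_ /(_ _ _ loop1)[? ? m1j]] := IHj _ _ WG' Wc' c'j.
have [_ /(_ _ _ bs)[_ _ n1k]] := binary_search_spec net.
split=> //; rewrite mulSn; lia.
Qed.

(** * Outer loop: descent of the function value *)

Variable j : nat.
Hypothesis j_large : L ^+ 2 * (1 - eps ^+ 2 / (64 * L ^+ 2)) ^+ j <= eps ^+ 2.
Hypothesis eps_leL : (0 < j)%N -> eps <= L.

(** The hypothesis says that the decrease still possible is worth fewer than [T] steps; a step uses
    up more than [delta * eps / 2], so it passes to [T - 1]. One call for the initial subgradient is
    added to the cost of each repeat loop. *)
Lemma modified_goldstein_sg_spec T x :
  (forall y, f x - f y < T%:R * (delta * eps / 2)) ->
  (exists xhat N, modified_goldstein_sg f delta eps x T xhat N) /\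
  forall xhat N, modified_goldstein_sg f delta eps x T xhat N ->
    goldstein_stationary delta eps f xhat /\
    (N <= T * (3 + j * (6 * k + 5)))%N.
Proof.
have [df _] := f_smooth.
have loop_spec y g0 : clarke f y g0 ->
    (exists g n, repeat_loop f delta eps y [:: g0] g n) /\
    forall g n, repeat_loop f delta eps y [:: g0] g n ->
    [/\ goldstein delta f y g, exit_test f delta eps y g
      & (n <= 2 + j * (6 * k + 5))%N].
  move=> yg0; apply: (@repeat_loop_spec j y [:: g0] g0).
  - move=> g /=; rewrite inE => /eqP->; exists y => //=.
    by rewrite subrr -(scale0r y) norm2Z normr0 mul0r ltW.
  - by apply: conv_hull1; rewrite /= mem_head.
  (* The initial subgradient has squared norm at most [L ^+ 2]. The power multiplying it is 1 for
     [j = 0], and nonnegative otherwise because [eps <= L]. *)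
  apply: le_trans j_large; rewrite ler_wpM2r//.
    have [->|/eps_leL epsL] := posnP j; first by rewrite expr0.
    apply: exprn_ge0; rewrite subr_ge0 ler_pdivrMr ?mulr_gt0 ?exprn_gt0// mul1r.
    have : eps ^+ 2 <= L ^+ 2 by rewrite lerXn2r ?nnegrE ?(ltW eps_gt0) ?(ltW L_gt0).
    by have := sqr_ge0 L; lra.
  rewrite -norm2_sqr lerXn2r ?nnegrE ?norm2_ge0 ?(ltW L_gt0)//.
  by apply: norm2_clarke_le yg0 => //; exact: ltW.
elim: T x => [|T IHT] x fx.
  (* With no iteration left, taking [y := x] makes the hypothesis [0 < 0]: the budget cannot run out
     before a stop. *)
  by have := fx x; rewrite subrr mul0r ltxx.
have next g : exit_test f delta eps x g -> eps < norm2 g -> forall y,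
    f (x - delta *: unit_dir g) - f y < T%:R * (delta * eps / 2).
  move=> [dec|/le_lt_trans le] epsg y; last by have := le _ epsg; rewrite ltxx.
  have := fx y; rewrite -natr1 mulrDl mul1r.
  have : delta * eps < delta * norm2 g by rewrite ltr_pM2l.
  lra.
split.
  have xg := clarke_grad (df x).
  have [[g [n loop]] all] := loop_spec _ _ xg.
  have [ge|ge] := leP (norm2 g) eps.
    by exists x, n.+1; exact: (gsg_stop _ xg loop ge).
  have [_ et _] := all _ _ loop.
  have [[xhat [N run]] _] := IHT _ (next _ et ge).
  by exists xhat, (n.+1 + N)%N; exact: (gsg_step xg loop ge run).
move=> xhat N run.
inversion run as [|x1 T1 g0 g n xg loop ge|x1 T1 g0 g n xhat1 m xg loop ge run1];
  subst.
  have [_ /(_ _ _ loop)[gold _ nj]] := loop_spec _ _ xg.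
  split; first by exists g.
  rewrite mulSn; lia.
have [_ /(_ _ _ loop)[gold et nj]] := loop_spec _ _ xg.
have [_ /(_ _ _ run1)[stat mT]] := IHT _ (next _ et ge).
split=> //; rewrite mulSn; lia.
Qed.

End Algorithm.

(** * Numbers of halvings and of contractions *)

Section Counts.
Context {R : realType}.

Lemma ex_nat_ceil (x : R) : 0 <= x -> exists n : nat,
  [/\ (0 < n)%N, x < n%:R & n%:R <= x + 1].
Proof.
move=> x0; exists (Num.truncn x).+1.
have /andP[xl xu] := truncn_itv x0.
by split=> //; rewrite -natr1 lerD2r.
Qed.

(** After taking logarithms, [k * ln 2] must dominate [ln c + M * ln 2 + ln y]. Both maxima are at
    least 1, so their product [B] dominates 1, [M] and [ln y] separately, and the sum is bounded by
    a multiple of [B]. *)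
Lemma halvings_count (c M y : R) : 0 < c -> 0 < y -> exists k : nat,
  c * 2 `^ M * y <= 2 ^+ k /\
  k%:R <= ((`|ln c| + 1) / ln 2 + 2) * (Num.max 1 M * Num.max 1 (ln y)).
Proof.
move=> c0 y0; set B := _ * Num.max 1 (ln y).
have m1 : 1 <= Num.max 1 M :> R by rewrite le_max lexx.
have y1 : 1 <= Num.max 1 (ln y) :> R by rewrite le_max lexx.
have M1 : M <= Num.max 1 M by rewrite le_max lexx orbT.
have lny1 : ln y <= Num.max 1 (ln y) by rewrite le_max lexx orbT.
have B1 : 1 <= B by rewrite -[leLHS]mulr1 ler_pM.
have BM : M <= B by rewrite (le_trans M1)// ler_peMr// (le_trans ler01).
have By : ln y <= B by rewrite (le_trans lny1)// ler_peMl// (le_trans ler01).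
have ln2 : 0 < ln 2 :> R by rewrite ln_gt0// ltr1n.
have A0 : 0 <= (`|ln c| + 1) / ln 2 by rewrite divr_ge0 ?addr_ge0// ltW.
set A := _ / ln 2 in A0 *.
(* The summand [A] pays for [ln c] and [ln y], the summand 1 for [M * ln 2]; rounding up costs at
   most one more [B]. *)
have [|k [_ kl ku]] := @ex_nat_ceil ((A + 1) * B); first by apply: mulr_ge0; lra.
exists k; split; last by rewrite (le_trans ku)//; lra.
have p0 : 0 < 2 `^ M :> R by rewrite powR_gt0.
rewrite -[leLHS]lnK ?posrE ?mulr_gt0// -[2 ^+ k]lnK ?posrE ?exprn_gt0//.
rewrite ler_expR !lnM ?posrE ?mulr_gt0// ln_powR lnXn// -[_ *+ k]mulr_natl.
have kln : (A + 1) * B * ln 2 <= k%:R * ln 2 by rewrite ler_pM2r// ltW.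
apply: (le_trans _ kln).
have -> : (A + 1) * B * ln 2 = (`|ln c| + 1) * B + B * ln 2.
  by rewrite /A; field; rewrite gt_eqF.
have cB : `|ln c| <= `|ln c| * B by rewrite ler_peMr.
have MB : M * ln 2 <= B * ln 2 by rewrite ler_pM2r.
have := ler_norm (ln c).
lra.
Qed.

(** With [r := eps ^+ 2 / (64 * L ^+ 2)], the bound [(1 - r) ^+ j <= expR (- (r * j))] reduces the
    goal to [2 * ln (L / eps) <= r * j], that is, [j] at least 128 times the second argument of the
    maximum; rounding up gives 129. If [L <= eps], then [j = 0] suffices. *)
Lemma shrinkings_count (L eps : R) : 0 < L -> 0 < eps -> exists j : nat,
  [/\ L ^+ 2 * (1 - eps ^+ 2 / (64 * L ^+ 2)) ^+ j <= eps ^+ 2,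
      ((0 < j)%N -> eps <= L) &
      j%:R <= 129 * Num.max 1 (L ^+ 2 / eps ^+ 2 * ln (L / eps))].
Proof.
move=> L0 e0.
have [Le|eL] := leP L eps.
  exists 0; split=> //.
    by rewrite expr0 mulr1 lerXn2r ?nnegrE ?(ltW L0) ?(ltW e0).
  by rewrite mulr_ge0// le_max ler01.
set Z := _ * ln (L / eps).
have Z0 : 0 <= Z.
  rewrite mulr_ge0 ?divr_ge0 ?sqr_ge0// ln_ge0//.
  by rewrite ler_pdivlMr// mul1r ltW.
have [|j [_ jl ju]] := @ex_nat_ceil (128 * Z); first by rewrite mulr_ge0.
exists j; split.
- set r := eps ^+ 2 / (64 * L ^+ 2).
  have e2L2 : eps ^+ 2 <= L ^+ 2 by rewrite lerXn2r ?nnegrE ?(ltW L0) ?(ltW e0) ?(ltW eL).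
  have r1 : 0 <= 1 - r.
    rewrite subr_ge0 ler_pdivrMr ?mulr_gt0 ?exprn_gt0// mul1r.
    by have := sqr_ge0 L; lra.
  have rj : (1 - r) ^+ j <= expR (- (r * j%:R)).
    rewrite mulr_natr -mulNrn -[_ *+ j]mulr_natl expRM_natl lerXn2r ?nnegrE ?expR_ge0//.
    exact: expR_ge1Dx.
  have : expR (- (r * j%:R)) <= (eps / L) ^+ 2.
    rewrite -[leRHS]lnK ?posrE ?exprn_gt0 ?divr_gt0// ler_expR lnXn ?divr_gt0//.
    rewrite -[eps / L]invf_div lnV ?posrE ?divr_gt0// mulNrn lerN2.
    have -> : ln (L / eps) *+ 2 = r * (128 * Z).
      by rewrite /r /Z -mulr_natl; field; rewrite !gt_eqF.
    by rewrite ler_wpM2l ?ltW// divr_gt0 ?mulr_gt0 ?exprn_gt0.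
  move=> /(le_trans rj); rewrite -(ler_pM2l (_ : 0 < L ^+ 2)) ?exprn_gt0//.
  move=> /le_trans; apply.
  by rewrite -exprMn mulrCA divff ?gt_eqF// mulr1.
- by move=> _; exact: ltW.
- apply: le_trans ju _.
  have : 1 <= Num.max 1 Z by rewrite le_max lexx.
  have : Z <= Num.max 1 Z by rewrite le_max lexx orbT.
  lra.
Qed.

End Counts.

(** * Assembling the oracle bound *)

Lemma function_class_le (R : realType) (d : nat) (Delta L : R)
    (f : 'rV[R]_d -> R) y : function_class Delta L f -> f 0 - f y <= Delta.
Proof.
move=> [_]; rewrite -lee_fin; apply: le_trans.
rewrite EFinB leeB//; apply: ereal_inf_lbound.
by exists y.
Qed.

Theorem theorem6p3 (R : realType) (c1 c2 : R) (c1_gt0 : 0 < c1)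
    (c1_le_c2 : c1 <= c2) :
  exists2 K : R, 0 < K &
  forall (d : nat) (f : 'rV[R]_d -> R) (Delta L M ell eps delta : R),
    (1 <= d)%N -> 0 < Delta -> 0 < L -> 0 < M ->
    function_class Delta L f ->
    c1 * 2 `^ M <= ell -> ell <= c2 * 2 `^ M -> smooth ell f ->
    0 < eps -> eps < 1 -> 0 < delta -> delta < 1 ->
    exists T : nat,
      [/\ (0 < T)%N,
          exists (xhat : 'rV[R]_d) (N : nat),
            modified_goldstein_sg f delta eps 0 T xhat N
        & forall (xhat : 'rV[R]_d) (N : nat),
            modified_goldstein_sg f delta eps 0 T xhat N ->
            goldstein_stationary delta eps f xhat /\
            N%:R <= K * oracle_bound Delta L M delta eps].
Proof.
have c2_gt0 : 0 < c2 by exact: lt_le_trans c1_le_c2.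
have ln2 : 0 < ln 2 :> R by rewrite ln_gt0// ltr1n.
pose A := (`|ln (4 * c2)| + 1) / ln 2 + 2.
have A0 : 0 < A by rewrite ltr_wpDl// divr_ge0 ?addr_ge0// ltW.
(* The first 3 comes from [T <= 2 * P + 1 <= 3 * P], the 129 from [j], and [6 * A + 5] from
   [6 * k + 5 <= (6 * A + 5) * B]; the inner 3 is absorbed by [1 <= Q * B]. *)
exists (3 * (3 + 129 * (6 * A + 5))); first lra.
move=> d f Delta L M ell eps delta _ Delta0 L0 M0 fDL ell1 ell2 fs e0 _ d0 _.
have ell0 : 0 <= ell.
  by apply: le_trans ell1; rewrite mulr_ge0 ?powR_ge0 ?ltW.
have [|T [T0 Tl Tu]] := @ex_nat_ceil R (2 * (Delta / (delta * eps))).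
  by rewrite mulr_ge0// divr_ge0// ltW// mulr_gt0.
(* The factor [4 * c2] comes from [ell * delta / (eps / 4)] once [ell] is replaced by its upper
   bound. *)
have [||k [kl ku]] := @halvings_count _ (4 * c2) M (delta / eps).
- by rewrite mulr_gt0.
- by rewrite divr_gt0.
have [j [jl jL ju]] := shrinkings_count L0 e0.
have delta_le : ell * delta <= 2 ^+ k * (eps / 4).
  apply: (@le_trans _ _ (c2 * 2 `^ M * delta)); first by rewrite ler_pM2r.
  have -> : c2 * 2 `^ M * delta = 4 * c2 * 2 `^ M * (delta / eps) * (eps / 4).
    by field; rewrite gt_eqF.
  by rewrite ler_pM2r// divr_gt0.
have [|ex all] := @modified_goldstein_sg_spec R d f L ell delta eps
  L0 fDL.1 ell0 fs e0 d0 k delta_le j jl jL T 0.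
  move=> y; apply: le_lt_trans (function_class_le y fDL) _.
  have -> : Delta = 2 * (Delta / (delta * eps)) * (delta * eps / 2).
    by field; rewrite !gt_eqF.
  by rewrite ltr_pM2r// divr_gt0// mulr_gt0.
exists T; split=> // xhat N /all[stat NT]; split=> //.
rewrite /oracle_bound; set B := _ * Num.max 1 (ln _) in ku *.
set P := Num.max 1 (Delta / _); set Q := Num.max 1 (_ * ln _) in ju *.
have P1 : 1 <= P by rewrite le_max lexx.
have Q1 : 1 <= Q by rewrite le_max lexx.
have B1 : 1 <= B by rewrite -[leLHS]mulr1 ler_pM// le_max lexx.
have QB1 : 1 <= Q * B by rewrite -[leLHS]mulr1 ler_pM.
apply: (@le_trans _ _ (T%:R * (3 + j%:R * (6 * k%:R + 5)))).
  by rewrite -!(natrM, natrD) ler_nat.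
have -> : 3 * (3 + 129 * (6 * A + 5)) * (P * Q * B) =
  (3 * P) * ((3 + 129 * (6 * A + 5)) * (Q * B)) by ring.
have DP : Delta / (delta * eps) <= P by rewrite le_max lexx orbT.
have step : j%:R * (6 * k%:R + 5) <= 129 * Q * ((6 * A + 5) * B).
  by apply: ler_pM => //; rewrite -/A in ku; lra.
have K0 : 0 <= j%:R * (6 * k%:R + 5) :> R by rewrite mulr_ge0// addr_ge0// mulr_ge0.
by apply: ler_pM => //; lra.
Qed.
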